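(* Let $I=[0,1]$ or $I=[0,\infty)$ and let $X$ be a Banach function space on $I$ such that the abstract Cesàro function space $CX$ satisfies $CX\neq\{0\}$. Then there are numbers $0<a<b<m(I)$ such that $$\left\|\tfrac1x\chi_{[b,m(I))}(x)\right\|_X\,\|f\|_{L^1(I)}\le \|f\|_{CX}\le \left\|\tfrac1x\chi_{[a,m(I))}(x)\right\|_X\,\|f\|_{L^1(I)}$$ for all $f\in CX$ with $\operatorname{supp}(f)\subset[a,b]$. In particular, $CX$ contains a complemented copy of $L^1[0,1]$ (a complemented closed subspace isomorphic to $L^1[0,1]$).
   Context: $m$ is Lebesgue measure on $I$ (so $m(I)=1$ or $\infty$), and $L^0(I)$ is the space of (a.e. equivalence classes of) real-valued Lebesgue measurable functions on $I$. A Banach function space $X$ on $I$ is a Banach space that is a linear subspace of $L^0(I)$ with the ideal property: $|f|\le|g|$ a.e., $f\in L^0(I)$, $g\in X$ imply $f\in X$ and $\|f\|_X\le\|g\|_X$; by convention $X$ is also assumed to contain a function positive a.e. on $I$ (this is not assumed for the derived space $CX$). $\operatorname{supp}(f)=\{x\in I: f(x)\ne0\}$. The norm of a function depending on $x$ is written by its formula in $x$. Cesàro operator: $Cf(x)=\frac1x\int_0^x f(t)\,dt$ for $0<x\in I$. Abstract Cesàro function space: $CX=\{f\in L^0(I): C|f|\in X\}$ with norm $\|f\|_{CX}=\|C|f|\|_X$. *)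

(* Defs.v *)
From HB Require Import structures.
From mathcomp Require Import all_boot all_order all_algebra.
From mathcomp Require Import all_classical all_reals all_analysis.

Set Implicit Arguments.
Unset Strict Implicit.
Unset Printing Implicit Defensive.
Import Order.TTheory GRing.Theory Num.Theory.
Import numFieldNormedType.Exports.
Local Open Scope classical_set_scope.
Local Open Scope ring_scope.

(* The real line with the sigma-algebra of Lebesgue (not only Borel) measurable
   sets; its carrier is convertible to R. *)
Definition lebesgueR (R : realType) :=
  caratheodory_type ((@wlength R idfun)^*)%mu.

Notation leb := (@completed_lebesgue_measure _).

Definition Lmfun (R : realType) : lmodType R := {mfun lebesgueR R >-> R}.

(** The space L^0(I): Lebesgue measurable functions modulo equality a.e. on I.
    Representatives are defined on the whole line (every measurable function on
    a measurable I extends by 0), but their values outside I are irrelevant. *)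
Section L0.
Context {R : realType} (I : set R).

Definition null_on : {pred Lmfun R} := fun f =>
  `[< {ae leb, forall x, I x -> f x = 0} >].

Lemma null_on_submod_closed : submod_closed null_on.
Proof.
split=> [|c f g /asboolP f0 /asboolP g0]; apply/asboolP.
  by apply: aeW => x _.
have FF := @ae_filter_ringOfSetsType _ (lebesgueR R) R leb.
apply: filterS2 f0 g0 => x fx gx Ix.
by rewrite -[LHS]/(c * f x + g x) fx// gx// mulr0 addr0.
Qed.

HB.instance Definition _ := GRing.isSubmodClosed.Build R (Lmfun R) null_on
  null_on_submod_closed.

Local Open Scope quotient_scope.

Definition L0 : Type := Quotient.quot null_on.

HB.instance Definition _ := GRing.Zmodule.on L0.
HB.instance Definition _ := EqQuotient.on L0.

Definition L0_fun (f : L0) : lebesgueR R -> R :=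
  (repr f : {mfun lebesgueR R >-> R}).

Definition L0_scale (c : R) (f : L0) : L0 := \pi_L0 (c *: (repr f : Lmfun R)).

Lemma L0_piD (f g : Lmfun R) : \pi_L0 (f + g) = \pi_L0 f + \pi_L0 g.
Proof. exact: raddfD. Qed.

Lemma L0_piP (f g : Lmfun R) : reflect (\pi_L0 f = \pi_L0 g) (f - g \in null_on).
Proof. by rewrite Quotient.idealrBE; exact: eqP. Qed.

Lemma L0_scale_pi c (f : Lmfun R) : L0_scale c (\pi_L0 f) = \pi_L0 (c *: f).
Proof.
apply/L0_piP; rewrite -scalerBr; apply: rpredZ; apply/L0_piP.
exact: reprK.
Qed.

Lemma L0_scaleA a b f : L0_scale a (L0_scale b f) = L0_scale (a * b) f.
Proof. by rewrite [LHS]L0_scale_pi scalerA. Qed.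

Lemma L0_scale1 : left_id 1 L0_scale.
Proof. by move=> f; rewrite -[RHS]reprK /L0_scale scale1r. Qed.

Lemma L0_scaleDr : right_distributive L0_scale +%R.
Proof.
move=> c f g; rewrite -{1}[f]reprK -{1}[g]reprK -L0_piD [LHS]L0_scale_pi.
by rewrite scalerDr L0_piD.
Qed.

Lemma L0_scaleDl f : {morph L0_scale^~ f : a b / a + b}.
Proof. by move=> a b; rewrite /L0_scale scalerDl L0_piD. Qed.

HB.instance Definition _ := GRing.Zmodule_isLmodule.Build R L0
  L0_scaleA L0_scale1 L0_scaleDr L0_scaleDl.

Lemma L0P (f g : L0) :
  f = g <-> {ae leb, forall x, I x -> L0_fun f x = L0_fun g x}.
Proof.
have FF := @ae_filter_ringOfSetsType _ (lebesgueR R) R leb.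
have fgE x : (repr f - repr g : {mfun lebesgueR R >-> R}) x =
    L0_fun f x - L0_fun g x by [].
rewrite -{1}[f]reprK -{1}[g]reprK; split=> [/L0_piP/asboolP|fg].
  apply: filterS => x fg0 Ix.
  by apply/eqP; rewrite -subr_eq0 -fgE fg0.
apply/L0_piP/asboolP; apply: filterS fg => x fgx Ix.
by rewrite fgE fgx// subrr.
Qed.

End L0.

Coercion L0_fun : L0 >-> Funclass.

Definition L1 (R : realType) (I : set R) : set (L0 I) :=
  [set f | leb.-integrable I (EFin \o f)].

Definition L1_norm (R : realType) (I : set R) (f : L0 I) : \bar R :=
  (\int[leb]_(x in I) `|f x|%:E)%E.

(** Banach function spaces. The inclusion of X in L^0(I) is an injective linear
    map. *)
Record banach_function_space (R : realType) (I : set R) := BanachFunctionSpace {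
  bfs_space :> completeNormedModType R;
  bfs_incl : {linear bfs_space -> L0 I};
  bfs_incl_inj : injective bfs_incl;
  bfs_ideal : forall (f : L0 I) (g : bfs_space),
    {ae leb, forall x, I x -> `|f x| <= `|(bfs_incl g : L0 I) x|} ->
    exists2 h : bfs_space, bfs_incl h = f & `|h| <= `|g|;
  bfs_pos : exists g : bfs_space, {ae leb, forall x, I x -> 0 < (bfs_incl g : L0 I) x} }.

Section membership_and_norm.
Context {R : realType} {I : set R} (X : banach_function_space I).

(* The formula h, which may take infinite values on a null set, is a
   representative of the element g of X. *)
Definition bfs_represents (h : R -> \bar R) (g : X) : Prop :=
  {ae leb, forall x, I x -> h x = ((bfs_incl X g : L0 I) x)%:E}.

Definition bfs_mem (h : R -> \bar R) : Prop := exists g, bfs_represents h g.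

(* At most one g is represented by h, so that this is `|g| if h belongs to X,
   and +oo otherwise. *)
Definition bfs_norm (h : R -> \bar R) : \bar R :=
  ereal_inf [set (`|g|)%:E | g in bfs_represents h].

End membership_and_norm.

(* To be applied to nonnegative functions; the integral may be infinite. *)
Definition cesaro (R : realType) (h : R -> \bar R) (x : R) : \bar R :=
  ((x^-1)%:E * \int[leb]_(t in `[0%R, x]) h t)%E.

(* The function (1/x) * chi_[c, m(I))(x). *)
Definition recip_tail (R : realType) (I : set R) (c x : R) : \bar R :=
  (x^-1 * \1_([set y | c <= y /\ (y%:E < leb I)%E]) x)%:E.

Section cesaro_space.
Context {R : realType} {I : set R} (X : banach_function_space I).

Definition CX : set (L0 I) :=
  [set f | bfs_mem X (cesaro (fun t => `|f t|%:E))].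

Definition CX_norm (f : L0 I) : \bar R :=
  bfs_norm X (cesaro (fun t => `|f t|%:E)).

End cesaro_space.

(** Subspaces and operators, for normed spaces given as a subspace E of a
    vector space V with a function nE : V -> \bar R which is a norm on E. *)
Section normed_subspaces.
Context {R : realType}.

Definition linear_subspace (V : lmodType R) (M : set V) : Prop :=
  M 0 /\ forall (c : R) f g, M f -> M g -> M (c *: f + g).

Definition bounded_linear (V W : lmodType R) (E : set V) (nE : V -> \bar R)
    (F : set W) (nF : W -> \bar R) (T : V -> W) : Prop :=
  [/\ forall f, E f -> F (T f),
      forall (c : R) f g, E f -> E g -> T (c *: f + g) = c *: T f + T g
    & exists C : R, forall f, E f -> (nF (T f) <= C%:E * nE f)%E].

Definition closed_in (V : lmodType R) (E : set V) (nE : V -> \bar R)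
    (M : set V) : Prop :=
  forall f, E f ->
    (forall e : R, 0 < e -> exists2 g, M g & (nE (f - g)%R < e%:E)%E) -> M f.

Definition complemented_in (V : lmodType R) (E : set V) (nE : V -> \bar R)
    (M : set V) : Prop :=
  exists P : V -> V, [/\ bounded_linear E nE E nE P,
    forall f, E f -> M (P f) & forall f, M f -> P f = f].

Definition isomorphic (V W : lmodType R) (E : set V) (nE : V -> \bar R)
    (F : set W) (nF : W -> \bar R) : Prop :=
  exists (T : V -> W) (S : W -> V),
    [/\ bounded_linear E nE F nF T, bounded_linear F nF E nE S,
        forall f, E f -> S (T f) = f & forall g, F g -> T (S g) = g].

Definition contains_complemented_copy (V W : lmodType R)
    (E : set V) (nE : V -> \bar R) (F : set W) (nF : W -> \bar R) : Prop :=
  exists M : set V, [/\ M `<=` E, linear_subspace M, closed_in E nE M,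
    complemented_in E nE M & isomorphic F nF M nE].

End normed_subspaces.

(* Main.v *)
Require Import Defs.
From HB Require Import structures.
From mathcomp Require Import all_boot all_order all_algebra.
From mathcomp Require Import all_classical all_reals all_analysis.

From mathcomp Require Import measurable_realfun.
Set Implicit Arguments.
Unset Strict Implicit.
Unset Printing Implicit Defensive.
Import Order.TTheory GRing.Theory Num.Theory.
Import numFieldNormedType.Exports.
Local Open Scope classical_set_scope.
Local Open Scope ring_scope.

(** Write F(x) for the integral of |f| over [0, x], so that the Cesaro mean of |f|
    at x is F(x) / x. Since F is nondecreasing, F(x) / x >= F(a) / x for x >= a;
    this gives F(a) ||chi_[a, m(I)) / x||_X <= ||f||_CX for every f in CX
    (cesaro_ge_tail). If f vanishes below a, then F vanishes below a and is at most
    ||f||_1 elsewhere, whence ||f||_CX <= ||chi_[a, m(I)) / x||_X ||f||_1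
    (cesaro_le_tail). When f lives on [a, b], F(b) = ||f||_1, and the first
    inequality at b together with the second at a is the claimed estimate.

    The tails chi_[a, m(I)) / x must belong to X. A nonzero f in CX has F(a) > 0
    for some a < m(I) (cumul_neq0), and F(a) is finite because F(x) / x is finite
    a.e. (cumul_lty), so the ideal property and cesaro_ge_tail put the tail at a,
    and at any larger b < m(I), in X.

    For the complemented copy, take the elements of CX supported in [a, b]. On
    this subspace the estimate says that the norm of CX is equivalent to the
    L^1-norm, and the affine bijection of [0, 1] onto [a, b] identifies it with
    L^1[0, 1] (CX_on_isomorphic). Multiplication by chi_[a, b] is a projection of
    norm at most one onto it (CX_on_complemented), which also makes it closed
    (CX_on_closed).

    Two measure-theoretic facts support this. The ideal property applies only to
    measurable functions, so F must be measurable; it is, being monotone. The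
    dilation of [0, 1] must act on Lebesgue, not only Borel, measurable functions
    and their classes; this follows from the Borel case because every Lebesgue
    measurable set is a Borel set up to a null set. *)

(** * Affine changes of variable for Lebesgue measure *)

(** Carries over to Lebesgue measurable sets what the uniqueness of Lebesgue
    measure gives for Borel sets. *)
Lemma lebesgue_measurable_decomp {R : realType} (A : set (lebesgueR R)) :
  measurable A -> exists (B : set (measurableTypeR R)) (N : set R),
    [/\ measurable B, lebesgue_measure.-negligible (N : set (measurableTypeR R))
      & A = B `|` N].
Proof.
rewrite -completed_caratheodory_measurable g_sigma_completed_algebra_genE.
by move=> [B mB [N negN <-]]; exists B, N.
Qed.

Definition affine_map {R : realType} (a c x : R) : R := a + c * x.

Section affine.
Context {R : realType}.
Variables a c : R.
Hypothesis c_gt0 : 0 < c.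
Local Notation phi := (affine_map a c).

Lemma affine_preimage_itv (u v : R) :
  phi @^-1` `]u, v] = `](u - a) / c, (v - a) / c]%classic.
Proof.
apply/seteqP; split => x; rewrite /affine_map /= !in_itv/=.
  by rewrite ltr_pdivrMr// ler_pdivlMr// ltrBlDl lerBrDl mulrC.
by rewrite ltr_pdivrMr// ler_pdivlMr// ltrBlDl lerBrDl [x * c]mulrC.
Qed.

Lemma measurable_affine_borel :
  measurable_fun [set: measurableTypeR R] (phi : measurableTypeR R -> measurableTypeR R).
Proof.
by apply: measurable_funD => //; exact: measurable_funM.
Qed.

(** As functions of A both sides are Borel measures, and they agree on the
    intervals ]u, v]. *)
Lemma lebesgue_measure_affine (A : set (measurableTypeR R)) : measurable A ->
  lebesgue_measure A = (c%:E * lebesgue_measure (phi @^-1` A))%E.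
Proof.
pose pm := measure_function_pushforward__canonical__measure_function_Measure
  lebesgue_measure measurable_affine_borel.
have c0 : 0 <= c by exact: ltW.
pose mu : {measure set (measurableTypeR R) -> \bar R} :=
  mscale (NngNum c0) pm.
move=> mA; rewrite -[RHS]/(mu A); apply: lebesgue_measure_unique mA.
move=> _ [[u v]] /= _ <-.
rewrite /mu/= /mscale/= /pushforward/= affine_preimage_itv !lebesgue_measure_itv/=.
rewrite !lte_fin ltr_pM2r ?invr_gt0// ltrD2r.
case: ifPn => // _; last by rewrite mule0.
rewrite -!EFinB -EFinM; congr _%:E.
by rewrite -mulrBl mulrCA divff ?gt_eqF// mulr1 opprB addrA subrK.
Qed.

(** Reduces the affine invariance of null sets to Borel sets. *)
Lemma negligible_borel_cover (N : set R) :
  leb.-negligible (N : set (lebesgueR R)) ->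
  exists B : set (measurableTypeR R),
    [/\ measurable B, lebesgue_measure B = 0%E & N `<=` B].
Proof.
move=> [A [mA A0 NA]].
have [B [N' [mB [C [mC C0 N'C]] ABN']]] := lebesgue_measurable_decomp mA.
exists (B `|` C); split.
- exact: measurableU.
- apply/eqP; rewrite eq_le measure_ge0 andbT.
  apply: (le_trans (outer_measureU2 _ _ _)).
  rewrite [X in (_ + X)%E](_ : _ = 0%E)// adde0 -A0.
  apply: le_outer_measure; rewrite ABN'; exact: subsetUl.
- move=> x /NA; rewrite ABN' => -[Bx|N'x]; [by left|right; exact: N'C].
Qed.

Lemma negligible_affine (N : set R) : leb.-negligible (N : set (lebesgueR R)) ->
  leb.-negligible (phi @^-1` N : set (lebesgueR R)).
Proof.
move=> /negligible_borel_cover[B [mB B0 NB]].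
have mphiB : measurable (phi @^-1` B : set (measurableTypeR R)).
  by rewrite -[X in measurable X]setTI; exact: measurable_affine_borel.
exists (phi @^-1` B); split; last exact: preimage_subset.
  exact: sub_caratheodory.
have := lebesgue_measure_affine mB; rewrite B0 => /esym/eqP.
by rewrite mule_eq0 eqe gt_eqF//= => /eqP.
Qed.

Lemma measurable_affine :
  measurable_fun [set: lebesgueR R] (phi : lebesgueR R -> lebesgueR R).
Proof.
move=> _ A mA; rewrite setTI.
have [B [N [mB [C [mC C0 NC]] ->]]] := lebesgue_measurable_decomp mA.
rewrite preimage_setU; apply: measurableU.
  apply: sub_caratheodory.
  by rewrite -[X in measurable X]setTI; exact: measurable_affine_borel.
apply: negligible_sub_caratheodory; apply: negligible_affine.
by exists C; split => //; exact: sub_caratheodory.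
Qed.

Lemma completed_lebesgue_measure_affine (A : set (lebesgueR R)) : measurable A ->
  leb A = (c%:E * leb (phi @^-1` A : set (lebesgueR R)))%E.
Proof.
move=> /lebesgue_measurable_decomp[B [N [mB [C [mC C0 NC]] ABN]]].
have negN : leb.-negligible (N : set (lebesgueR R)).
  by exists C; split => //; exact: sub_caratheodory.
have outU (B' N' : set (lebesgueR R)) : leb.-negligible N' ->
    leb (B' `|` N') = leb B'.
  move=> [D [mD D0 ND]]; apply/eqP; rewrite eq_le; apply/andP; split.
    apply: (le_trans (outer_measureU2 _ _ _)).
    rewrite [X in (_ + X)%E](_ : _ = 0%E) ?adde0//.
    apply/eqP; rewrite eq_le outer_measure_ge0 andbT -D0.
    exact: le_outer_measure.
  by apply: le_outer_measure; exact: subsetUl.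
rewrite ABN preimage_setU !outU//; last exact: negligible_affine.
exact: lebesgue_measure_affine.
Qed.

Lemma integral_affine (D : set (lebesgueR R)) (f : lebesgueR R -> \bar R) :
  measurable D -> measurable_fun D f -> (forall x, D x -> 0 <= f x)%E ->
  (\int[leb]_(x in D) f x =
   c%:E * \int[leb]_(x in (phi @^-1` D : set (lebesgueR R))) f (phi x))%E.
Proof.
move=> mD mf f0.
pose pm := measure_function_pushforward__canonical__measure_function_Measure
  leb measurable_affine.
have c0 : 0 <= c by exact: ltW.
have mphiD : measurable (phi @^-1` D : set (lebesgueR R)).
  by rewrite -[X in measurable X]setTI; exact: measurable_affine.
rewrite -(ge0_integral_pushforward measurable_affine leb mD mf); last first.
  by move=> x; rewrite inE; exact: f0.
rewrite -(ge0_integral_mscale pm mD (NngNum c0))//.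
apply: eq_measure_integral => A mA _.
by rewrite [LHS]completed_lebesgue_measure_affine.
Qed.

End affine.

(** Meant for the integral of |f| over [0, x] as a function of x, which may be
    infinite a priori. *)
Lemma measurable_fun_nondecreasing {R : realType} (F : R -> \bar R) :
  {homo F : x y / x <= y >-> (x <= y)%E} ->
  measurable_fun [set: lebesgueR R] (F : lebesgueR R -> \bar R).
Proof.
move=> F_nd; apply: (measurability _ (ErealGenCInfty.measurableE R)).
move=> _ [_ [r ->] <-]; rewrite setTI.
apply: sub_caratheodory; apply: is_interval_measurable => s t/=.
rewrite !in_itv/= !andbT => fs ft u /andP[su ut].
by rewrite in_itv/= andbT (le_trans fs)// F_nd.
Qed.

(** * Lebesgue measurable functions *)
#[local] Instance leb_ae_filter (R : realType) :
  Filter (almost_everywhere (leb : set (lebesgueR R) -> \bar R)) :=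
  @ae_filter_ringOfSetsType _ (lebesgueR R) R leb.

Lemma borel_lebesgue_measurable {R : realType} d (T : measurableType d) (f : R -> T) :
  measurable_fun [set: measurableTypeR R] (f : measurableTypeR R -> T) ->
  measurable_fun [set: lebesgueR R] (f : lebesgueR R -> T).
Proof.
move=> mf _ A mA; rewrite setTI; apply: sub_caratheodory.
by rewrite -[X in measurable X]setTI; exact: mf.
Qed.

Lemma measurable_invr {R : realType} :
  measurable_fun [set: lebesgueR R] (@GRing.inv R : lebesgueR R -> R).
Proof.
apply: borel_lebesgue_measurable.
rewrite -(setUv [set (0 : R)]); apply/measurable_funU => //.
- exact: measurableC.
- split; first exact: measurable_fun_set1.
  apply: open_continuous_measurable_fun.
    by apply: closed_openC; exact: closed_eq.
  by move=> x /set_mem/eqP x0; exact: inv_continuous.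
Qed.

Lemma measurable_itv_lebesgue {R : realType} (i : interval R) :
  measurable ([set` i] : set (lebesgueR R)).
Proof. by apply: sub_caratheodory; exact: measurable_itv. Qed.

Section L0_lemmas.
Context {R : realType} {I : set R}.
Implicit Types f g : L0 I.

Lemma L0_measurable f : measurable_fun [set: lebesgueR R] (f : lebesgueR R -> R).
Proof. exact: measurable_funP. Qed.

Lemma L0_abs_measurable (D : set (lebesgueR R)) f : measurable D ->
  measurable_fun D (fun x : lebesgueR R => (`|f x|%R)%:E).
Proof.
move=> mD; apply: measurable_funTS; apply/measurable_EFinP.
by apply: measurableT_comp => //; exact: L0_measurable.
Qed.

(** The default value 0 lets an operator on classes be defined by a formula before
    the formula is known to be measurable. *)
Definition L0_class (f : lebesgueR R -> R) : L0 I :=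
  match pselect (measurable_fun [set: lebesgueR R] f) with
  | left mf => \pi_(L0 I)%qT (mfun_Sub (mem_set mf) : Lmfun R)
  | right _ => 0
  end.

Lemma L0_classE (f : lebesgueR R -> R) : measurable_fun [set: lebesgueR R] f ->
  {ae leb, forall x, I x -> L0_class f x = f x}.
Proof.
move=> mf; rewrite /L0_class; case: pselect => // mf'.
have /asboolP : repr (\pi_(L0 I)%qT (mfun_Sub (mem_set mf') : Lmfun R))
    - (mfun_Sub (mem_set mf') : Lmfun R) \in null_on I.
  by apply/L0_piP; rewrite reprK.
apply: filterS => x /[apply]; set u := repr _ => /eqP.
rewrite -[(u - _) x]/((u : {mfun lebesgueR R >-> R}) x -
  (mfun_Sub (mem_set mf') : {mfun lebesgueR R >-> R}) x).
by rewrite subr_eq0 => /eqP.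
Qed.

Lemma L0_scaleD (c : R) f g :
  {ae leb, forall x, I x -> (c *: f + g : L0 I) x = c * f x + g x}.
Proof.
have -> : c *: f + g = \pi_(L0 I)%qT (c *: (repr f : Lmfun R) + repr g).
  by rewrite L0_piD reprK.
have /asboolP : repr (\pi_(L0 I)%qT (c *: (repr f : Lmfun R) + repr g))
    - (c *: (repr f : Lmfun R) + repr g) \in null_on I.
  by apply/L0_piP; rewrite reprK.
apply: filterS => x /[apply]; set u := repr (\pi_(L0 I)%qT _) => /eqP.
rewrite -[(u - _) x]/((u : {mfun lebesgueR R >-> R}) x - (c * f x + g x)).
by rewrite subr_eq0 => /eqP.
Qed.

Lemma L0_0 : {ae leb, forall x, I x -> (0 : L0 I) x = 0}.
Proof.
have := L0_scaleD (-1) 0 0; rewrite scaler0 addr0; apply: filterS => x /[apply].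
by rewrite mulN1r addNr.
Qed.

End L0_lemmas.

(** * Norms of formulas in a Banach function space *)
Section bfs.
Context {R : realType} {I : set R} (X : banach_function_space I).
Implicit Types (h k : lebesgueR R -> \bar R) (u v : X).
Local Notation represents := (@bfs_represents R I X).

Lemma bfs_represents_unique h u v :
  represents h u -> represents h v -> u = v.
Proof.
move=> hu hv; apply: (bfs_incl_inj (b := X)); apply/L0P.
by apply: filterS2 hu hv => x hu hv Ix; apply: EFin_inj; rewrite -hu// -hv.
Qed.

Lemma bfs_norm_represented h u : represents h u -> bfs_norm X h = `|u|%:E.
Proof.
move=> hu; rewrite /bfs_norm (_ : [set _ | _ in _] = [set `|u|%:E]) ?ereal_inf1//.
apply/seteqP; split => [_ [v hv <-]|_ ->]; last by exists u.
by rewrite (bfs_represents_unique hv hu).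
Qed.

Lemma bfs_norm_ge0 h : (0 <= bfs_norm X h)%E.
Proof. by apply: le_ereal_inf_tmp => _ [v _ <-]; rewrite lee_fin. Qed.

Lemma bfs_norm_lty_mem h : (bfs_norm X h < +oo)%E -> bfs_mem X h.
Proof. by move/ereal_inf_lt => [_ [v hv _] _]; exists v. Qed.

(** The formula h is finite a.e. because it is dominated, so its real part is a
    representative of h to which the ideal property of X applies. *)
Lemma bfs_ideal_formula h u : measurable_fun [set: lebesgueR R] h ->
  {ae leb, forall x, I x -> (`|h x| <= `|(bfs_incl X u : L0 I) x|%:E)%E} ->
  exists2 v, represents h v & `|v| <= `|u|.
Proof.
move=> mh hu.
have mfh : measurable_fun [set: lebesgueR R] (fine \o h).
  by apply: measurableT_comp => //; exact: measurable_fine.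
have hE := L0_classE (I := I) mfh.
have hfin : {ae leb, forall x, I x -> h x = (L0_class (I := I) (fine \o h) x)%:E}.
  apply: filterS2 hu hE => x hu hE Ix; rewrite hE//= fineK//.
  by rewrite fin_num_abs (le_lt_trans (hu Ix))// ltry.
have [|v vE vu] := @bfs_ideal _ _ X (L0_class (fine \o h)) u.
  apply: filterS2 hu hfin => x hu hfin Ix.
  by move: (hu Ix); rewrite hfin.
by exists v => //; rewrite /bfs_represents vE.
Qed.

Lemma bfs_norm_mono h k : measurable_fun [set: lebesgueR R] h ->
  {ae leb, forall x, I x -> (`|h x| <= `|k x|)%E} -> bfs_mem X k ->
  bfs_mem X h /\ (bfs_norm X h <= bfs_norm X k)%E.
Proof.
move=> mh hk [u ku].
have [|v hv vu] := @bfs_ideal_formula h u mh.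
  by apply: filterS2 hk ku => x hk ku Ix; rewrite (le_trans (hk Ix))// ku.
split; first by exists v.
by rewrite (bfs_norm_represented hv) (bfs_norm_represented ku) lee_fin.
Qed.

Lemma bfs_represents_scaleD (c : R) h k u v :
  represents h u -> represents k v ->
  represents (fun x => c%:E * h x + k x)%E (c *: u + v).
Proof.
move=> hu kv; rewrite /bfs_represents linearD linearZ.
apply: filterS3 hu kv (L0_scaleD c (bfs_incl X u) (bfs_incl X v)).
by move=> x hu kv E Ix; rewrite hu// kv// E// EFinD EFinM.
Qed.

Lemma bfs_norm_scale (c : R) h : 0 <= c -> bfs_mem X h ->
  bfs_mem X (fun x => c%:E * h x)%E /\
  bfs_norm X (fun x => c%:E * h x)%E = (c%:E * bfs_norm X h)%E.
Proof.
move=> c0 [u hu].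
have chu : represents (fun x => c%:E * h x)%E (c *: u).
  have k0 : represents (fun=> 0%E) (0 : X).
    by rewrite /bfs_represents linear0; apply: filterS L0_0 => x /[apply] ->.
  have := bfs_represents_scaleD c hu k0; rewrite addr0.
  by apply: filterS => x /[apply]; rewrite adde0.
split; first by exists (c *: u).
rewrite (bfs_norm_represented chu) (bfs_norm_represented hu) normrZ.
by rewrite ger0_norm// EFinM.
Qed.

End bfs.

Lemma integral_norm_scaleD_le d (T : measurableType d) (R : realType)
    (mu : {measure set T -> \bar R}) (D : set T) (c : R) (f g h : T -> R) :
  measurable D -> measurable_fun [set: T] f -> measurable_fun [set: T] g ->
  measurable_fun [set: T] h -> {ae mu, forall x, D x -> h x = c * f x + g x} ->
  (\int[mu]_(x in D) `|h x|%:E <=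
   `|c|%:E * \int[mu]_(x in D) `|f x|%:E + \int[mu]_(x in D) `|g x|%:E)%E.
Proof.
move=> mD mf mg mh hE.
have mabs (k : T -> R) : measurable_fun [set: T] k ->
    measurable_fun D (fun x => `|k x|%:E).
  move=> mk; apply/measurable_EFinP; apply: measurable_funTS.
  exact: measurableT_comp.
rewrite -ge0_integralZl//; last exact: mabs.
rewrite -ge0_integralD//; last 2 first.
- by apply: measurable_funeM; exact: mabs.
- exact: mabs.
apply: ae_ge0_le_integral => //.
- exact: mabs.
- by move=> t _; rewrite -EFinM -EFinD lee_fin addr_ge0// mulr_ge0.
- by apply: emeasurable_funD; [apply: measurable_funeM|]; exact: mabs.
- apply: filterS hE => t E /E ->.
  by rewrite -EFinM -EFinD lee_fin -normrM ler_normD.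
Qed.

(** * The interval I *)
Section domain.
Context {R : realType} {I : set R}.
Hypothesis hI : I = `[0, 1]%classic \/ I = `[0, +oo[%classic.

Lemma domain_measurable : measurable (I : set (lebesgueR R)).
Proof. by case: hI => ->; exact: measurable_itv_lebesgue. Qed.

Lemma domain_ge0 x : I x -> 0 <= x.
Proof. by case: hI => -> /=; rewrite in_itv/= => /andP[]. Qed.

Lemma domain_lengthE : leb I = 1%:E \/ leb I = +oo%E.
Proof.
rewrite -[leb I]/(lebesgue_measure I).
case: hI => ->; rewrite lebesgue_measure_itv/=; [left|right].
  by rewrite lte_fin ltr01 oppr0 adde0.
by rewrite ltry.
Qed.

Lemma domain_lt x : 0 <= x -> (x%:E < leb I)%E -> I x.
Proof.
rewrite -[leb I]/(lebesgue_measure I).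
case: hI => ->; rewrite lebesgue_measure_itv/= => x0; last first.
  by rewrite in_itv/= x0.
by rewrite lte_fin ltr01 oppr0 adde0 lte_fin in_itv/= x0 => /ltW.
Qed.

Lemma domain_itv x : (x%:E < leb I)%E -> `[0, x]%classic `<=` I.
Proof.
move=> xI y /=; rewrite in_itv/= => /andP[y0 yx].
by apply: domain_lt => //; rewrite (le_lt_trans _ xI)// lee_fin.
Qed.

Lemma domain_ae_lt : {ae leb, forall x, I x -> (x%:E < leb I)%E}.
Proof.
exists [set 1]; split.
- by apply: sub_caratheodory; exact: measurable_set1.
- exact: (lebesgue_measure_set1 1).
- move=> x /= /not_implyP[]; rewrite -[leb I]/(lebesgue_measure I).
  case: hI => ->; rewrite lebesgue_measure_itv/= in_itv/=; last first.
    by move=> _; rewrite ltry oppr0 adde0 ltry => /(_ isT).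
  rewrite lte_fin ltr01 oppr0 adde0 lte_fin => /andP[_ x1] /negP.
  by rewrite -leNgt => x1'; apply/eqP; rewrite eq_le x1.
Qed.

Lemma domain_between x : (x%:E < leb I)%E -> exists2 y, x < y & (y%:E < leb I)%E.
Proof.
case: domain_lengthE => ->; rewrite ?lte_fin => x1.
  have [xm m1] := midf_lt x1.
  by exists ((x + 1) / 2); rewrite // lte_fin.
by exists (x + 1); rewrite ?ltrDl ?ltr01 ?ltry.
Qed.

Lemma domain_length_gt0 : (0 < leb I)%E.
Proof. by case: domain_lengthE => ->; rewrite ?lte_fin ?ltr01. Qed.

(** Nondegenerate intervals inside I are not null. *)
Lemma domain_ae_exists (P : R -> Prop) (a b : R) :
  {ae leb, forall x, I x -> P x} -> 0 <= a -> a < b -> (b%:E < leb I)%E ->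
  exists x, [/\ a < x, x < b & P x].
Proof.
move=> [N [mN N0 PN]] a0 ab bI; apply: contrapT => nP.
have abN : `]a, b[%classic `<=` N.
  move=> x /=; rewrite in_itv/= => /andP[ax xb]; apply: PN => /= Px.
  apply: nP; exists x; split => //; apply: Px; apply: domain_lt.
    by rewrite (le_trans a0)// ltW.
  by rewrite (lt_trans _ bI)// lte_fin.
have : (lebesgue_measure (`]a, b[%classic : set R) <= 0)%E.
  by rewrite -N0; exact: le_outer_measure.
by rewrite lebesgue_measure_itv/= lte_fin ab -EFinB lee_fin leNgt subr_gt0 ab.
Qed.

(** * Cesaro means *)
Implicit Types f g : L0 I.

Definition cumul f (x : R) : \bar R := (\int[leb]_(t in `[0%R, x]) `|f t|%:E)%E.

Lemma cumul_ge0 f x : (0 <= cumul f x)%E.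
Proof. by apply: integral_ge0 => t _; rewrite lee_fin. Qed.

Lemma cumul_homo f : {homo cumul f : x y / x <= y >-> (x <= y)%E}.
Proof.
move=> x y xy; apply: ge0_subset_integral.
- exact: measurable_itv_lebesgue.
- exact: measurable_itv_lebesgue.
- by apply: L0_abs_measurable; exact: measurable_itv_lebesgue.
- by move=> t _; rewrite lee_fin.
- by move=> t /=; rewrite !in_itv/= => /andP[-> tx]; exact: le_trans xy.
Qed.

Lemma cumul_le_norm f x : (x%:E < leb I)%E -> (cumul f x <= L1_norm f)%E.
Proof.
move=> xI; apply: ge0_subset_integral; last exact: domain_itv.
- exact: measurable_itv_lebesgue.
- exact: domain_measurable.
- by apply: L0_abs_measurable; exact: domain_measurable.
- by move=> t _; rewrite lee_fin.
Qed.

Lemma cumul_mono f g x : {ae leb, forall t, I t -> `|f t| <= `|g t|} ->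
  (x%:E < leb I)%E -> (cumul f x <= cumul g x)%E.
Proof.
move=> fg xI; apply: ae_ge0_le_integral.
- exact: measurable_itv_lebesgue.
- by move=> t _; rewrite lee_fin.
- by apply: L0_abs_measurable; exact: measurable_itv_lebesgue.
- by move=> t _; rewrite lee_fin.
- by apply: L0_abs_measurable; exact: measurable_itv_lebesgue.
- apply: filterS fg => t fgt /(domain_itv xI) It.
  by rewrite lee_fin fgt.
Qed.

Lemma cumul_scaleD (c : R) f g x : (x%:E < leb I)%E ->
  (cumul (c *: f + g)%R x <= `|c|%:E * cumul f x + cumul g x)%E.
Proof.
move=> xI; have mi := measurable_itv_lebesgue `[0, x].
apply: (integral_norm_scaleD_le mi); [exact: L0_measurable..|].
apply: filterS (L0_scaleD c f g).
by move=> t E /(domain_itv xI) /E.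
Qed.

Lemma cumul_supp_le f b : (b%:E < leb I)%E ->
  {ae leb, forall x, I x -> f x != 0 -> x <= b} -> cumul f b = L1_norm f.
Proof.
move=> bI fb; rewrite /cumul /L1_norm.
have -> : `[0, b]%classic = I `&` `[0, b]%classic.
  by apply/esym/setIidPr; exact: domain_itv.
rewrite integral_mkcondr; apply: ge0_ae_eq_integral.
- exact: domain_measurable.
- apply: measurable_funTS; apply/(measurable_restrictT _ _).1.
    exact: measurable_itv_lebesgue.
  by apply: L0_abs_measurable; exact: measurable_itv_lebesgue.
- by apply: L0_abs_measurable; exact: domain_measurable.
- by move=> x _; rewrite patchE; case: ifPn => // _; rewrite lee_fin.
- by move=> x _; rewrite lee_fin.
- apply: filterS fb => x fbx Ix; rewrite patchE; case: ifPn => //.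
  rewrite notin_setE/= in_itv/= (domain_ge0 Ix)/= => xb.
  by case: (eqVneq (f x) 0) => [->|/(fbx Ix)//]; rewrite normr0.
Qed.

Lemma cumul_supp_ge f a x : (x%:E < leb I)%E -> x < a ->
  {ae leb, forall x, I x -> f x != 0 -> a <= x} -> cumul f x = 0%E.
Proof.
move=> xI xa fa; rewrite /cumul; have mi := measurable_itv_lebesgue `[0, x].
transitivity
    (\int[leb]_(t in (`[0%R, x]%classic : set (lebesgueR R))) cst 0%E t : \bar R)%E;
  last exact: integral0.
apply: ge0_ae_eq_integral.
- exact: mi.
- exact: L0_abs_measurable.
- exact: measurable_cst.
- by move=> t _; rewrite lee_fin.
- by move=> t _; exact: lexx.
- apply: filterS fa => t fat tx; have It := domain_itv xI tx.
  case: (eqVneq (f t) 0) => [->|/(fat It) at_]; first by rewrite normr0.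
  move: tx; rewrite /= in_itv/= => /andP[_ tx].
  by move: (le_lt_trans (le_trans at_ tx) xa); rewrite ltxx.
Qed.

(** Otherwise f vanishes a.e. on [0, q] for each of the countably many rationals
    q < m(I), and these intervals exhaust I up to a null set. *)
Lemma cumul_neq0 f : f <> 0 ->
  exists a, [/\ 0 < a, (a%:E < leb I)%E & cumul f a != 0%E].
Proof.
move=> f0; apply: contrapT => nf; apply: f0.
have {}nf a : 0 < a -> (a%:E < leb I)%E -> cumul f a = 0%E.
  by move=> a0 aI; apply: contrapT => fa; apply: nf; exists a; split => //; exact/eqP.
apply/L0P.
have Q n : {ae leb, forall x, I x -> forall q : rat, unpickle n = Some q ->
    ((ratr q : R)%:E < leb I)%E -> x < ratr q -> f x = 0}.
  case: (unpickle n) => [q|]; last by apply: aeW.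
  have [q0|q0] := leP (ratr q : R) 0.
    apply: aeW => x Ix q' [<-] _ xq.
    by have := domain_ge0 Ix; rewrite leNgt (lt_le_trans xq q0).
  have [qI|qI] := ltP (ratr q)%:E (leb I); last first.
    by apply: aeW => x _ q' [<-]; rewrite ltNge qI.
  have mi := measurable_itv_lebesgue `[0, (ratr q : R)].
  have mf : measurable_fun (`[0, (ratr q : R)]%classic : set (lebesgueR R))
      (EFin \o (f : lebesgueR R -> R)).
    by apply: measurable_funTS; apply/measurable_EFinP; exact: L0_measurable.
  have /(_ (nf _ q0 qI)) := (ae_eq_integral_abs leb mi mf).1.
  apply: filterS => x H Ix q' [<-] _ xq.
  have : `[0, (ratr q : R)]%classic x by rewrite /= in_itv/= (domain_ge0 Ix) ltW.
  by move=> /H [].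
apply: filterS3 domain_ae_lt (ae_foralln Q)
  (L0_0 (I := I)) => x xI Qx x0 Ix.
rewrite x0//; have [y xy yI] := domain_between (xI Ix).
have [q] := rat_in_itvoo xy; rewrite inE/= => /andP[xq qy].
apply: (Qx (pickle q) Ix q (pickleK q)) => //.
by rewrite (lt_trans _ yI)// lte_fin.
Qed.

Lemma cesaro_measurable f :
  measurable_fun [set: lebesgueR R]
    (Defs.cesaro (fun t => `|f t|%:E) : lebesgueR R -> \bar R).
Proof.
apply: emeasurable_funM; first by apply/measurable_EFinP; exact: measurable_invr.
by apply: measurable_fun_nondecreasing; exact: cumul_homo.
Qed.

Lemma recip_tail_measurable a :
  measurable_fun [set: lebesgueR R] (recip_tail I a : lebesgueR R -> \bar R).
Proof.
apply/measurable_EFinP; apply: measurable_funM; first exact: measurable_invr.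
apply: measurable_indic; apply: sub_caratheodory; apply: is_interval_measurable.
move=> x y [ax xI] [ay yI] z /andP[xz zy]; split; first exact: le_trans xz.
by rewrite (le_lt_trans _ yI)// lee_fin.
Qed.

Lemma recip_tailE a x : (x%:E < leb I)%E ->
  recip_tail I a x = (if a <= x then (x^-1)%:E else 0%E).
Proof.
move=> xI; rewrite /recip_tail indicE; case: ifPn => ax.
  by rewrite mem_set ?mulr1//; split.
by rewrite memNset ?mulr0// => -[ax' _]; rewrite ax' in ax.
Qed.

End domain.

(** * The space CX *)
Section cesaro_space.
Context {R : realType} {I : set R}.
Hypothesis hI : I = `[0, 1]%classic \/ I = `[0, +oo[%classic.
Context (X : banach_function_space I).
Implicit Types f g : L0 I.
Local Notation represents := (@bfs_represents R I X).
Local Notation cesaro f := (Defs.cesaro (fun t => `|f t|%:E)).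

Lemma cesaro_ge0 f x : I x -> (0 <= cesaro f x)%E.
Proof.
move=> Ix; apply: mule_ge0; last exact: cumul_ge0.
by rewrite lee_fin invr_ge0 (domain_ge0 hI).
Qed.

Lemma CX_ideal f g : {ae leb, forall x, I x -> `|f x| <= `|g x|} -> CX X g ->
  CX X f /\ (CX_norm X f <= CX_norm X g)%E.
Proof.
move=> fg gX; apply: bfs_norm_mono gX; first exact: cesaro_measurable.
apply: filterS (domain_ae_lt hI) => x xI Ix.
rewrite !gee0_abs ?cesaro_ge0//; apply: lee_wpmul2l.
  by rewrite lee_fin invr_ge0 (domain_ge0 hI).
by apply: cumul_mono => //; exact: xI.
Qed.

Lemma CX_0 : CX X 0.
Proof.
exists 0; rewrite /bfs_represents linear0.
apply: filterS2 (domain_ae_lt hI) (L0_0 (I := I)) => x xI x0 Ix.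
rewrite x0// /Defs.cesaro -/(cumul (0 : L0 I) x).
rewrite (@cumul_supp_ge _ _ hI _ (x + 1)) ?mule0 ?ltrDl//; first exact: xI.
by apply: filterS (L0_0 (I := I)) => y /[apply] ->; rewrite eqxx.
Qed.

Lemma CX_scaleD (c : R) f g : CX X f -> CX X g -> CX X (c *: f + g).
Proof.
move=> [u fu] [v gv].
have uv := bfs_represents_scaleD `|c| fu gv.
suff [] : CX X (c *: f + g) /\ (CX_norm X (c *: f + g)%R <=
    bfs_norm X (fun x => `|c|%:E * cesaro f x + cesaro g x))%E by [].
apply: bfs_norm_mono; last by exists (`|c| *: u + v).
  exact: cesaro_measurable.
apply: filterS (domain_ae_lt hI) => x xI Ix.
have x0 : (0 <= x^-1%:E :> \bar R)%E by rewrite lee_fin invr_ge0 (domain_ge0 hI).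
rewrite !gee0_abs ?cesaro_ge0//; last first.
  by apply: adde_ge0; [apply: mule_ge0 => //|]; exact: cesaro_ge0.
rewrite /Defs.cesaro -/(cumul f x) -/(cumul g x) muleCA.
rewrite -ge0_muleDr ?mule_ge0 ?cumul_ge0//.
by apply: lee_wpmul2l => //; apply: cumul_scaleD => //; exact: xI.
Qed.

(** The Cesaro mean of |f| is finite a.e., hence at some x > a, and the integral of
    |f| over [0, x] dominates the one over [0, a]. *)
Lemma cumul_lty f a : CX X f -> (a%:E < leb I)%E -> (cumul f a < +oo)%E.
Proof.
move=> [u fu] aI.
wlog a0 : a aI / 0 <= a => [wlg|].
  have [/wlg|a0] := leP 0 a; first exact.
  apply: (@le_lt_trans _ _ (cumul f 0)); first exact/cumul_homo/ltW.
  by apply: wlg => //; exact: domain_length_gt0.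
have [b ab bI] := domain_between hI aI.
have [x [ax xb]] := domain_ae_exists hI fu a0 ab bI.
have x0 : 0 < x by exact: le_lt_trans ax.
rewrite ltNge leye_eq => xu; apply/negP => /eqP fa.
have : cumul f x = +oo%E.
  by apply/eqP; rewrite -leye_eq -fa; exact/cumul_homo/ltW.
move=> fx; move: xu; rewrite /Defs.cesaro -/(cumul f x) fx.
by rewrite gt0_muley// lte_fin invr_gt0.
Qed.

(** For x >= a the Cesaro mean of |f| at x is at least 1/x times the integral of
    |f| over [0, a]. *)
Lemma cesaro_ge_tail f a : CX X f -> 0 < a -> (a%:E < leb I)%E ->
  (cumul f a != 0%E -> bfs_mem X (recip_tail I a)) /\
  (bfs_norm X (recip_tail I a) * cumul f a <= CX_norm X f)%E.
Proof.
move=> fX a0 aI; have fay := cumul_lty fX aI.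
have fa_fin : cumul f a \is a fin_num by rewrite ge0_fin_numE ?cumul_ge0.
pose c := fine (cumul f a); have cE : cumul f a = c%:E by rewrite fineK.
have c0 : 0 <= c by rewrite fine_ge0 ?cumul_ge0.
have [cX cn] : bfs_mem X (fun x => c%:E * recip_tail I a x)%E /\
    (bfs_norm X (fun x => c%:E * recip_tail I a x) <= CX_norm X f)%E.
  apply: bfs_norm_mono fX.
    by apply: measurable_funeM; exact: recip_tail_measurable.
  apply: filterS (domain_ae_lt hI) => x /[swap] Ix /(_ Ix) xI.
  rewrite recip_tailE//; case: ifPn => ax; last first.
    by rewrite mule0 abse0 abse_ge0.
  have x0 : 0 < x by exact: lt_le_trans ax.
  rewrite !gee0_abs ?cesaro_ge0 ?mule_ge0 ?lee_fin ?invr_ge0 ?(ltW x0)//.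
  rewrite /Defs.cesaro -/(cumul f x) muleC -cE. apply: lee_wpmul2l.
    by rewrite lee_fin invr_ge0 ltW.
  exact: cumul_homo.
move: c0; rewrite le_eqVlt => /predU1P[c0|c0].
  (* Nothing is known about the tail here: its norm may be +oo. *)
  by rewrite cE -c0 eqxx mule0; split => //; exact: bfs_norm_ge0.
have cV0 : 0 <= c^-1 by rewrite invr_ge0 ltW.
have [rX _] := bfs_norm_scale cV0 cX.
have {}rX : bfs_mem X (recip_tail I a).
  move: rX; congr (bfs_mem X _); apply/funext => x.
  by rewrite -!EFinM mulrA mulVf ?gt_eqF// mul1r.
by split => //; rewrite cE muleC -(bfs_norm_scale (ltW c0) rX).2.
Qed.

Lemma recip_tail_norm_gt0 a : 0 < a -> (a%:E < leb I)%E ->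
  (0 < bfs_norm X (recip_tail I a))%E.
Proof.
move=> a0 aI; rewrite lt0e bfs_norm_ge0 andbT; apply/eqP => n0.
have [|u au] := @bfs_norm_lty_mem _ _ X (recip_tail I a); first by rewrite n0.
have u0 : u = 0.
  by apply/eqP; rewrite -normr_eq0 -eqe -(bfs_norm_represented au) n0.
have {}au : {ae leb, forall x, I x -> recip_tail I a x = 0%E}.
  move: au; rewrite /bfs_represents u0 linear0 => au.
  by apply: filterS2 au (L0_0 (I := I)) => x au x0 Ix; rewrite au// x0.
have [b ab bI] := domain_between hI aI.
have [x [ax xb]] := domain_ae_exists hI au (ltW a0) ab bI.
rewrite recip_tailE ?ltW//; last by rewrite (lt_trans _ bI)// lte_fin.
by move=> /eqP; rewrite eqe invr_eq0 gt_eqF// (lt_trans a0).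
Qed.

Lemma CX_norm_gt0 f : CX X f -> f <> 0 -> (0 < CX_norm X f)%E.
Proof.
move=> fX /(cumul_neq0 hI)[a [a0 aI fa]].
apply: lt_le_trans (cesaro_ge_tail fX a0 aI).2.
by rewrite mule_gt0 ?recip_tail_norm_gt0// lt0e fa cumul_ge0.
Qed.

(** The Cesaro mean of |f| vanishes below a, and elsewhere it is at most 1/x times
    the L^1-norm of f. *)
Lemma cesaro_le_tail f a : 0 < a -> bfs_mem X (recip_tail I a) ->
  {ae leb, forall x, I x -> f x != 0 -> a <= x} -> (L1_norm f < +oo)%E ->
  CX X f /\ (CX_norm X f <= bfs_norm X (recip_tail I a) * L1_norm f)%E.
Proof.
move=> a0 aX fa fy.
have f_ge0 : (0 <= L1_norm f)%E.
  by apply: integral_ge0 => x _; rewrite lee_fin.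
have f_fin : L1_norm f \is a fin_num by rewrite ge0_fin_numE.
pose c := fine (L1_norm f); have cE : L1_norm f = c%:E by rewrite fineK.
have c0 : 0 <= c by rewrite fine_ge0.
have [cX cn] := bfs_norm_scale c0 aX.
rewrite cE muleC -cn; apply: bfs_norm_mono cX; first exact: cesaro_measurable.
apply: filterS (domain_ae_lt hI) => x /[swap] Ix /(_ Ix) xI.
rewrite gee0_abs ?cesaro_ge0// recip_tailE// /Defs.cesaro -/(cumul f x).
case: ifPn => ax; last first.
  by rewrite (@cumul_supp_ge _ _ hI _ a)// ?mule0 ?abse_ge0// ltNge.
have x0 : 0 < x by exact: lt_le_trans ax.
rewrite gee0_abs ?mule_ge0 ?lee_fin ?invr_ge0 ?(ltW x0)// muleC -cE.
apply: lee_wpmul2r; first by rewrite lee_fin invr_ge0 ltW.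
exact: cumul_le_norm.
Qed.

End cesaro_space.

(** * Transport by an affine map *)
Lemma ae_affine {R : realType} (u c : R) (P : R -> Prop) : 0 < c ->
  {ae (leb : set (lebesgueR R) -> \bar R), forall x, P x} ->
  {ae (leb : set (lebesgueR R) -> \bar R), forall x, P (affine_map u c x)}.
Proof. by move=> c0 aeP; exact: (negligible_affine u c0 aeP). Qed.

Lemma L1P {R : realType} {I : set R} (f : L0 I) :
  measurable (I : set (lebesgueR R)) -> L1 f <-> (L1_norm f < +oo)%E.
Proof.
move=> mI; split => [/integrableP[]//|fy]; apply/integrableP; split => //.
by apply: measurable_funTS; apply/measurable_EFinP; exact: L0_measurable.
Qed.

Section transport.
Context {R : realType} {I J : set R} (B : set (lebesgueR R)) (u c : R).
Hypotheses (mI : measurable (I : set (lebesgueR R))) (mB : measurable B).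
Hypotheses (BI : B `<=` I) (c_gt0 : 0 < c).
Local Notation phi := (affine_map u c).

(** The class of (f chi_B) o phi. Cutting f off before composing makes sense of
    the values of f outside I, and covers at once multiplication by chi_[a, b]
    and the dilations of [0, 1] onto [a, b] and back. *)
Definition transport (f : L0 I) : L0 J :=
  L0_class (fun x => \1_B (phi x) * f (phi x)).

Let cut (f : L0 I) (x : lebesgueR R) : R := \1_B x * f x.

Let cut_measurable f : measurable_fun [set: lebesgueR R] (cut f).
Proof. by apply: measurable_funM; [exact: measurable_indic|exact: L0_measurable]. Qed.

Lemma transportE f :
  {ae leb, forall x, J x -> transport f x = \1_B (phi x) * f (phi x)}.
Proof.
apply: L0_classE; apply: (measurableT_comp (cut_measurable f)).
exact: measurable_affine.
Qed.

Lemma transport_scaleD (k : R) (f g : L0 I) :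
  transport (k *: f + g) = k *: transport f + transport g.
Proof.
apply/L0P.
have fgE := ae_affine u c_gt0 (L0_scaleD k f g).
have E : {ae leb, forall x, J x -> transport (k *: f + g) x =
    \1_B (phi x) * (k * f (phi x) + g (phi x))}.
  apply: filterS2 (transportE (k *: f + g)) fgE => x E fgE Jx; rewrite E//.
  have [Bx|Bx] := pselect (B (phi x)); first by rewrite fgE//; exact: BI.
  by rewrite indicE memNset// !mul0r.
have {}E : {ae leb, forall x, J x ->
    transport (k *: f + g) x = k * transport f x + transport g x}.
  apply: filterS3 E (transportE f) (transportE g) => x E fE gE Jx.
  by rewrite E// fE// gE// mulrDr mulrCA.
apply: filterS2 E (L0_scaleD k (transport f) (transport g)) => x E E' Jx.
by rewrite E// E'.
Qed.

(** Substitution over the whole line: the integral over J only gets larger when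
    extended to the line, and c times that is the integral of |f| over B. *)
Lemma transport_L1_norm f : measurable (J : set (lebesgueR R)) ->
  (c%:E * L1_norm (transport f) <= L1_norm f)%E.
Proof.
move=> mJ.
have mcut (D : set (lebesgueR R)) : measurable D ->
    measurable_fun D (fun x : lebesgueR R => `|cut f x|%:E).
  move=> mD; apply: measurable_funTS; apply/measurable_EFinP.
  by apply: measurableT_comp => //; exact: cut_measurable.
have mcutphi (D : set (lebesgueR R)) : measurable D ->
    measurable_fun D (fun x : lebesgueR R => `|cut f (phi x)|%:E).
  move=> mD; apply: measurable_funTS.
  apply: (measurableT_comp (mcut _ measurableT)); exact: measurable_affine.
have -> : L1_norm (transport f) = (\int[leb]_(x in J) `|cut f (phi x)|%:E)%E.
  apply: ge0_ae_eq_integral.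
  - exact: mJ.
  - exact: L0_abs_measurable.
  - exact: mcutphi.
  - by move=> x _; rewrite lee_fin.
  - by move=> x _; rewrite lee_fin.
  - by apply: filterS (transportE f) => x E Jx; rewrite E.
apply: (@le_trans _ _ (c%:E * \int[leb]_x `|cut f (phi x)|%:E)%E).
  apply: lee_wpmul2l; first by rewrite lee_fin ltW.
  apply: ge0_subset_integral; first exact: mJ.
  - exact: measurableT.
  - exact: mcutphi.
  - by move=> x _; rewrite lee_fin.
  - exact: subsetT.
have intE := integral_affine u c_gt0 measurableT (mcut _ measurableT).
rewrite preimage_setT in intE; rewrite -intE; last first.
  by move=> x _; rewrite lee_fin.
rewrite /L1_norm [leRHS]integral_mkcond; apply: ge0_le_integral.
- exact: measurableT.
- by move=> x _; rewrite lee_fin.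
- exact: mcut.
- by apply/(measurable_restrictT _ mI).1; exact: L0_abs_measurable.
- move=> x _; rewrite /cut patchE indicE.
  have [Bx|Bx] := pselect (B x); first by rewrite !mem_set ?mul1r//; exact: BI.
  by rewrite memNset// mul0r normr0; case: ifPn => // _; rewrite lee_fin.
Qed.

Lemma transport_supp f (A : set R) : phi @^-1` B `<=` A ->
  {ae leb, forall x, J x -> transport f x != 0 -> A x}.
Proof.
move=> BA; apply: filterS (transportE f) => x E Jx; rewrite E// => nz.
by apply: BA; apply: contrapT => Bx; rewrite indicE memNset ?mul0r ?eqxx in nz.
Qed.

End transport.

(** The inner class is determined only a.e. on J; as C is contained in J, the outer
    cut-off evaluates it nowhere else. *)
Lemma transportK {R : realType} {I J : set R} (B C : set (lebesgueR R))
    (u c v d : R) (f : L0 I) :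
  measurable B -> measurable C -> B `<=` I -> C `<=` J -> 0 < c -> 0 < d ->
  cancel (affine_map v d) (affine_map u c) ->
  (forall x, B x -> C (affine_map v d x)) ->
  {ae leb, forall x, I x -> f x != 0 -> B x} ->
  transport (J := I) C v d (transport (J := J) B u c f) = f.
Proof.
move=> mB mC BI CJ c0 d0 K BC fB; apply/L0P.
have E := ae_affine v d0 (transportE (J := J) u mB c0 f).
apply: filterS3 (transportE (J := I) v mC d0 (transport (J := J) B u c f)) E fB.
move=> x TE E fB Ix; rewrite TE//; have [Bx|Bx] := pselect (B x).
  have Cx := BC _ Bx.
  by rewrite E ?K; [rewrite !indicE !mem_set// !mul1r|exact: CJ].
have -> : f x = 0 by apply/eqP; apply: contrapT => /negP /(fB Ix).
have [Cx|Cx] := pselect (C (affine_map v d x)); last first.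
  by rewrite indicE memNset// mul0r.
by rewrite E ?K; [rewrite [\1_B _]indicE memNset// mul0r mulr0|exact: CJ].
Qed.

(** * The complemented copy of L^1[0, 1] *)
Section affine_inverse.
Context {R : realType}.
Implicit Types a b c x : R.

Lemma affine_map_id x : affine_map 0 1 x = x.
Proof. by rewrite /affine_map add0r mul1r. Qed.

Lemma affine_mapK a c : c != 0 ->
  cancel (affine_map a c) (affine_map (- (c^-1 * a)) c^-1).
Proof. by move=> c0 x; rewrite /affine_map mulrDr addKr mulKf. Qed.

Lemma affine_mapVK a c : c != 0 ->
  cancel (affine_map (- (c^-1 * a)) c^-1) (affine_map a c).
Proof.
by move=> c0 x; rewrite /affine_map mulrDr mulrN !mulVKf// addNKr.
Qed.

Lemma affine_map_unit_itv a b x : a < b ->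
  `[0, 1]%classic x <-> `[a, b]%classic (affine_map a (b - a) x).
Proof.
move=> ab; have ba0 : 0 < b - a by rewrite subr_gt0.
by rewrite /= !in_itv/= /affine_map lerDl pmulr_rge0// -lerBrDl ger_pMr.
Qed.

End affine_inverse.

Section copy.
Context {R : realType} {I : set R}.
Hypothesis hI : I = `[0, 1]%classic \/ I = `[0, +oo[%classic.
Context (X : banach_function_space I) (a b : R).
Hypotheses (a_gt0 : 0 < a) (ab : a < b) (bI : (b%:E < leb I)%E).
Hypotheses (aX : bfs_mem X (recip_tail I a)) (bX : bfs_mem X (recip_tail I b)).
Implicit Types f g : L0 I.

Definition CX_on : set (L0 I) :=
  [set f | CX X f /\ {ae leb, forall x, I x -> f x != 0 -> a <= x <= b}].

Local Notation ab_itv := (`[a, b]%classic : set (lebesgueR R)).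
Let b_gt0 : 0 < b. Proof. exact: lt_trans ab. Qed.
Let mI : measurable (I : set (lebesgueR R)). Proof. exact: domain_measurable. Qed.
Let m_ab : measurable ab_itv. Proof. exact: measurable_itv_lebesgue. Qed.
Let ab_sub : ab_itv `<=` I.
Proof.
move=> x /=; rewrite in_itv/= => /andP[ax xb]; apply: (domain_itv hI bI).
by rewrite /= in_itv/= xb (le_trans (ltW a_gt0)).
Qed.

Lemma CX_on_bounds f : CX_on f ->
  [/\ (bfs_norm X (recip_tail I b) * L1_norm f <= CX_norm X f)%E,
      (CX_norm X f <= bfs_norm X (recip_tail I a) * L1_norm f)%E
    & (L1_norm f < +oo)%E].
Proof.
move=> [fX fab].
have fb : cumul f b = L1_norm f.
  by apply: cumul_supp_le => //; apply: filterS fab => x fab Ix /(fab Ix)/andP[].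
have fy : (L1_norm f < +oo)%E by rewrite -fb (cumul_lty hI fX).
split => //; first by rewrite -fb; exact: (cesaro_ge_tail hI fX b_gt0 bI).2.
apply: (cesaro_le_tail hI a_gt0 aX _ fy).2.
by apply: filterS fab => x fab Ix /(fab Ix)/andP[].
Qed.

Definition cut_off : L0 I -> L0 I := transport ab_itv 0 1.

Lemma cut_offE f :
  {ae leb, forall x, I x -> cut_off f x = \1_ab_itv x * f x}.
Proof.
apply: filterS (transportE (J := I) 0 m_ab (@ltr01 R) f) => x E Ix.
by rewrite [LHS]E// !affine_map_id.
Qed.

Lemma cut_off_on f : CX X f -> CX_on (cut_off f).
Proof.
move=> fX; split.
  apply: (CX_ideal hI _ fX).1; apply: filterS (cut_offE f) => x E Ix.
  rewrite E// indicE; case: (x \in ab_itv); rewrite ?mul1r//.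
  by rewrite mul0r normr0.
apply: filterS (cut_offE f) => x E Ix; rewrite E// indicE => nz.
have xab : ab_itv x.
  by apply: contrapT => nx; rewrite memNset// mul0r eqxx in nz.
by move: xab; rewrite /= in_itv.
Qed.

Lemma cut_off_id f : CX_on f -> cut_off f = f.
Proof.
move=> [_ fab]; apply/L0P; apply: filterS2 (cut_offE f) fab => x E fab Ix.
rewrite E// indicE; have [xab|xab] := pselect (ab_itv x).
  by rewrite mem_set// mul1r.
rewrite memNset// mul0r; apply/esym/eqP; apply: contrapT => /negP /(fab Ix).
by move=> xab'; apply: xab; rewrite /= in_itv.
Qed.

Lemma cut_off_scaleD (k : R) f g :
  cut_off (k *: f + g) = k *: cut_off f + cut_off g.
Proof. exact: transport_scaleD. Qed.

Lemma cut_off_norm f : CX X f -> (CX_norm X (cut_off f) <= CX_norm X f)%E.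
Proof.
move=> fX; apply: (CX_ideal hI _ fX).2; apply: filterS (cut_offE f) => x E Ix.
by rewrite E// indicE; case: (x \in ab_itv); rewrite ?mul1r// mul0r normr0.
Qed.

Lemma CX_on_subspace : linear_subspace CX_on.
Proof.
split.
  split; first exact: CX_0.
  by apply: filterS (L0_0 (I := I)) => x /[apply] ->; rewrite eqxx.
move=> c f g fM gM.
rewrite -(cut_off_id fM) -(cut_off_id gM) -cut_off_scaleD.
by apply: cut_off_on; apply: (CX_scaleD hI); [exact: fM.1|exact: gM.1].
Qed.

(** For every g supported in [a, b], the part of f outside [a, b] is dominated by
    f - g; hence if f is a limit of such g, this part has norm 0. *)
Lemma CX_on_closed : closed_in (CX X) (CX_norm X) CX_on.
Proof.
move=> f fX f_lim; suff -> : f = cut_off f by exact: cut_off_on.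
(* h is the part of f outside [a, b]; an approximation of f within the norm of h
   gives a contradiction. *)
apply: contrapT => nf; pose h : L0 I := (-1) *: cut_off f + f.
have hX : CX X h by apply: (CX_scaleD hI) => //; exact: (cut_off_on fX).1.
have h0 : h <> 0.
  by rewrite /h scaleN1r addrC => /eqP; rewrite subr_eq0 => /eqP.
have [u hu] := hX; have hE := bfs_norm_represented hu.
have := CX_norm_gt0 hI hX h0; rewrite /CX_norm hE lte_fin => u0.
have [g [_ gab] fg] := f_lim _ u0.
have fgX : CX X (f - g) by apply: bfs_norm_lty_mem; rewrite (lt_trans fg)// ltry.
suff hfg : {ae leb, forall x, I x -> `|h x| <= `|(f - g : L0 I) x|}.
  have := (CX_ideal hI hfg fgX).2.
  by rewrite /CX_norm hE leNgt fg.
have fgE : f - g = (-1) *: g + f by rewrite scaleN1r addrC.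
rewrite fgE.
have hxE : {ae leb, forall x, I x -> h x = - (\1_ab_itv x * (f : L0 I) x) + (f : L0 I) x}.
  apply: filterS2 (L0_scaleD (-1) (cut_off f) f) (cut_offE f) => x E E' Ix.
  by rewrite /h E// mulN1r E'.
apply: filterS3 hxE (L0_scaleD (-1) g f) gab => x E E' gx Ix.
rewrite E// E'// indicE; have [xab|xab] := pselect (ab_itv x).
  by rewrite mem_set// mul1r addNr normr0.
rewrite memNset// mul0r oppr0 add0r.
have -> : (g : L0 I) x = 0; last by rewrite mulr0 add0r.
apply/eqP; apply: contrapT => /negP /(gx Ix) xab'.
by apply: xab; rewrite /= in_itv.
Qed.

Lemma CX_on_complemented : complemented_in (CX X) (CX_norm X) CX_on.
Proof.
exists cut_off; split; last exact: cut_off_id; last exact: cut_off_on.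
split; first by move=> f /cut_off_on[].
- by move=> k f g _ _; exact: cut_off_scaleD.
- by exists 1 => f fX; rewrite mul1e; exact: cut_off_norm.
Qed.

Local Notation unit_itv := (`[0, 1]%classic : set (lebesgueR R)).
Let m_unit : measurable unit_itv. Proof. exact: measurable_itv_lebesgue. Qed.
Local Notation len := (b - a).
Let len_gt0 : 0 < len. Proof. by rewrite subr_gt0. Qed.
Let lenV_gt0 : 0 < len^-1. Proof. by rewrite invr_gt0. Qed.
Let len_neq0 : len != 0. Proof. by rewrite gt_eqF. Qed.

Definition stretch : L0 (`[0, 1]%classic : set R) -> L0 I :=
  transport unit_itv (- (len^-1 * a)) len^-1.
Definition shrink : L0 I -> L0 (`[0, 1]%classic : set R) :=
  transport ab_itv a len.

Lemma stretch_on (f : L0 (`[0, 1]%classic : set R)) : (L1_norm f < +oo)%E ->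
  CX_on (stretch f) /\
  (CX_norm X (stretch f) <=
   (fine (bfs_norm X (recip_tail I a)) * len)%:E * L1_norm f)%E.
Proof.
move=> fy.
have norm_le : (L1_norm (stretch f) <= len%:E * L1_norm f)%E.
  rewrite -lee_pdivrMl//.
  exact: (transport_L1_norm _ m_unit m_unit (@subset_refl _ _) lenV_gt0).
have fab : {ae leb, forall x, I x -> stretch f x != 0 -> `[a, b]%classic x}.
  apply: transport_supp => // x; rewrite /preimage/= => ux.
  by rewrite -(affine_mapVK a len_neq0 x); apply/affine_map_unit_itv.
have {}fab : {ae leb, forall x, I x -> stretch f x != 0 -> a <= x <= b}.
  by apply: filterS fab => x fab Ix /(fab Ix); rewrite /= in_itv.
have Tfy : (L1_norm (stretch f) < +oo)%E.
  by rewrite (le_lt_trans norm_le)// lte_mul_pinfty ?lee_fin ?ltW.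
have fa : {ae leb, forall x, I x -> stretch f x != 0 -> a <= x}.
  by apply: filterS fab => x fab Ix /(fab Ix)/andP[].
have [TX Tn] := cesaro_le_tail hI a_gt0 aX fa Tfy.
split=> //; apply: (le_trans Tn).
have [u au] := aX; rewrite (bfs_norm_represented au)/= EFinM -muleA.
by apply: lee_wpmul2l; rewrite ?lee_fin.
Qed.

Lemma shrink_L1_norm f : CX_on f ->
  (L1_norm (shrink f) < +oo)%E /\
  (L1_norm (shrink f) <=
   (len^-1 * (fine (bfs_norm X (recip_tail I b)))^-1)%:E * CX_norm X f)%E.
Proof.
move=> fM; have [fb fa fy] := CX_on_bounds fM.
have norm_le : (L1_norm (shrink f) <= len^-1%:E * L1_norm f)%E.
  rewrite lee_pdivlMl//.
  exact: (transport_L1_norm _ mI m_ab ab_sub len_gt0).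
split; first by rewrite (le_lt_trans norm_le)// lte_mul_pinfty ?lee_fin ?ltW.
apply: (le_trans norm_le); rewrite EFinM -muleA; apply: lee_wpmul2l.
  by rewrite lee_fin ltW.
have [u bu] := bX; move: fb (recip_tail_norm_gt0 hI X b_gt0 bI).
rewrite (bfs_norm_represented bu)/= lte_fin => fb u0.
by rewrite lee_pdivlMl.
Qed.

Lemma CX_on_isomorphic :
  isomorphic (@L1 R `[0, 1]%classic) (@L1_norm R `[0, 1]%classic)
    CX_on (CX_norm X).
Proof.
exists stretch, shrink; split.
- split.
  + by move=> f /(L1P f m_unit)/stretch_on[].
  + by move=> k f g _ _; exact: transport_scaleD.
  + exists (fine (bfs_norm X (recip_tail I a)) * len) => f.
    by move=> /(L1P f m_unit)/stretch_on[].
- split.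
  + by move=> f /shrink_L1_norm[fy _]; exact/(L1P _ m_unit).
  + by move=> k f g _ _; exact: transport_scaleD.
  + exists (len^-1 * (fine (bfs_norm X (recip_tail I b)))^-1) => f.
    by move=> /shrink_L1_norm[].
- move=> f _; apply: transportK => //.
  + exact: affine_mapK.
  + by move=> x /affine_map_unit_itv; exact.
  + by apply: aeW => x.
- move=> f [_ fab]; apply: transportK => //.
  + exact: affine_mapVK.
  + move=> x abx; apply/(affine_map_unit_itv _ ab).
    by rewrite affine_mapVK.
Qed.

End copy.

Theorem lemma4p1 (R : realType) (I : set R)
    (hI : I = `[0, 1]%classic \/ I = `[0, +oo[%classic)
    (X : banach_function_space I)
    (hCX : CX X <> [set 0]) :
  (exists a b : R,
    [/\ 0 < a, a < b & (b%:E < leb I)%E] /\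
    [/\ bfs_mem X (recip_tail I a), bfs_mem X (recip_tail I b) &
      forall f : L0 I, CX X f ->
        {ae leb, forall x, I x -> f x != 0 -> a <= x <= b} ->
        (bfs_norm X (recip_tail I b) * L1_norm f <= CX_norm X f)%E /\
        (CX_norm X f <= bfs_norm X (recip_tail I a) * L1_norm f)%E]) /\
  contains_complemented_copy (CX X) (CX_norm X)
    (@L1 R `[0, 1]%classic) (@L1_norm R `[0, 1]%classic).
Proof.
have [f [fX f0]] : exists f, CX X f /\ f <> 0.
  apply: contrapT => nf; apply: hCX; apply/seteqP; split=> [f fX|_ ->].
    by apply: contrapT => f0; apply: nf; exists f.
  exact: CX_0.
have [a [a0 aI fa]] := cumul_neq0 hI f0.
have [b ab bI] := domain_between hI aI.
have b0 : 0 < b by exact: lt_trans ab.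
have fb : cumul f b != 0%E.
  rewrite gt_eqF// (lt_le_trans _ (cumul_homo f (ltW ab)))//.
  by rewrite lt0e fa cumul_ge0.
have aX := (cesaro_ge_tail hI fX a0 aI).1 fa.
have bX := (cesaro_ge_tail hI fX b0 bI).1 fb.
split.
  exists a, b; split=> //; split=> // g gX gab.
  by have [] := CX_on_bounds hI a0 ab bI aX (conj gX gab).
exists (CX_on X a b); split.
- by move=> g [].
- exact: (CX_on_subspace hI).
- exact: (CX_on_closed hI).
- exact: (CX_on_complemented hI).
- exact: (CX_on_isomorphic hI).
Qed.
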